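(* The polynomials $P_{-2,n}$ are orthogonal with respect to some weight function; that is, the sequence $\{\bar q_n\}_{n\ge0}$, $\bar q_n=P_{-2,2n+2}$, in which $\bar q_n$ has degree $n$, is a sequence of orthogonal polynomials with respect to some weight function on $\mathbb R$.
   Context: The polynomials $P_{-2,k}(c)$, $k\ge -4$, in the variable $c$ are defined by $P_{-2,-2}=1$, $P_{-2,-4}=P_{-2,-3}=P_{-2,-1}=0$ and $$(6+2k)P_{-2,k}(c)=4k\,c\,P_{-2,k-2}(c)-2(k-3)P_{-2,k-4}(c),\qquad k\ge 0.$$ All odd-indexed ones vanish. Set $\bar q_n=P_{-2,2n+2}$ for $n\ge -1$ (the degenerate initial terms $P_{-2,-2}=1$ and $P_{-2,0}=0$ are ignored). Then $\bar q_{-1}=0$, $\bar q_0=\frac15$, $\bar q_1=\frac{8c}{35}$, $\bar q_2=\frac{32c^2-7}{105}$, and $4(n+2)c\,\bar q_n=(2n+7)\bar q_{n+1}+(2n+1)\bar q_{n-1}$ for $n\ge0$. Orthogonality with respect to a weight function $w\ge 0$ on $\mathbb R$ (with finite moments) means $\int \bar q_n\,\overline{\bar q_m}\,w\,dc=0$ for $n\neq m$ and $\int|\bar q_n|^2\,w\,dc>0$ for all $n$, where here the outer overline on $\overline{\bar q_m}$ and the integration variable $c\in\mathbb R$ have their usual meanings. *)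

(* Defs.v *)
From HB Require Import structures.
From mathcomp Require Import all_boot all_order all_algebra.
From mathcomp Require Import all_classical all_reals all_analysis.
Set Implicit Arguments.
Unset Strict Implicit.
Unset Printing Implicit Defensive.
Import Order.TTheory GRing.Theory Num.Theory.
Local Open Scope ring_scope.

(* [P_shift R j] is P_{-2,j-4}: the index k >= -4 is shifted by 4 so that
   the recursion is structural on nat; in the last branch the index of the
   polynomial being defined is exactly k >= 0. *)
Fixpoint P_shift (R : realType) (j : nat) : {poly R} :=
  match j with
  | 2 => 1
  | ((k.+2) as k2).+2 =>
      (6 + 2 * k%:R)^-1 *:
        ((4 * k%:R) *: ('X * P_shift R k2)
         - (2 * (k%:R - 3)) *: P_shift R k)
  | _ => 0
  end.

(* P_{-2,k}; only k >= -4 is meaningful. *)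
Definition P_m2 (R : realType) (k : int) : {poly R} :=
  P_shift R (absz (k + 4)%R).

Lemma P_m2_init (R : realType) :
  [/\ P_m2 R (- 4) = 0, P_m2 R (- 3) = 0, P_m2 R (- 2) = 1
    & P_m2 R (- 1) = 0].
Proof. by []. Qed.

Lemma P_m2_rec (R : realType) (k : int) : 0 <= k ->
  (6 + 2 * k%:~R) *: P_m2 R k =
    (4 * k%:~R) *: ('X * P_m2 R (k - 2))
    - (2 * (k%:~R - 3)) *: P_m2 R (k - 4).
Proof.
case: k => // k _; rewrite /P_m2 subrK.
have -> : Posz k - 2 + 4 = Posz k.+2 by rewrite -addrA -PoszD addn2.
have -> : Posz k + 4 = Posz k.+4 by rewrite -PoszD addn4.
rewrite !absz_nat -pmulrn /= scalerA divff ?scale1r //.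
Qed.

Definition qbar (R : realType) (n : nat) : {poly R} :=
  P_m2 R (2 * n%:Z + 2).

(* The case k = 0 of the moment condition contains the measurability of w. *)
Definition is_weight (R : realType) (w : R -> R) : Prop :=
  (forall c : R, 0 <= w c) /\
  (forall k : nat,
     (@lebesgue_measure R).-integrable setT (fun c : R => (c ^+ k * w c)%:E)).

(* The polynomials have real coefficients and c is real, so the complex
   conjugation in the Hermitian inner product is the identity. *)
Definition orthogonal_wrt (R : realType) (q : nat -> {poly R}) (w : R -> R)
    : Prop :=
  (forall n m : nat, n <> m ->
     (\int[@lebesgue_measure R]_c ((q n).[c] * (q m).[c] * w c)%:E = 0)%E) /\
  (forall n : nat,
     (0 < \int[@lebesgue_measure R]_c (`|(q n).[c]| ^+ 2 * w c)%:E)%E).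

(* Main.v *)
Require Import Defs.
From mathcomp Require Import all_boot all_order all_algebra.
From mathcomp Require Import all_classical all_reals all_analysis.
From mathcomp Require Import measurable_realfun.
From mathcomp Require Import ring lra.
Set Implicit Arguments.
Unset Strict Implicit.
Unset Printing Implicit Defensive.
Import Order.TTheory GRing.Theory Num.Theory.
Import numFieldNormedType.Exports.
Local Open Scope ring_scope.

(** The weight is the boundary value of a ratio of minimal solutions of the
    three-term recurrence.  Put N = n + 1, so that the recurrence reads
      4 (N + 1) c y_N = (2 N + 5) y_(N+1) + (2 N - 1) y_(N-1)
    and the qbar_(N-1) are its solution with y_0 = 0, y_1 = 1/5.  For
    c = (z + 1/z) / 2 another solution is z^N Phi_N(z^2), where
      Phi_N(u) = sum_j msol_(N,j) u^j
    is a multiple of the hypergeometric series 2F1(-1/2, N + 1/2; N + 2; u)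
    ([msol_rec]); this is the solution that decays in N when |z| < 1.

    Divide by Phi_0 as formal power series, and let s_j be the coefficients
    of Phi_1/Phi_0.  The weight is supported on [-1, 1] and given there by
      w(cos t) = sum_j s_j sin((2 j + 1) t),
    the imaginary part of z Phi_1(z^2) / Phi_0(z^2) at z = e^(i t).  Since
    Phi_0/Phi_0 = 1 contributes no sines, the common recurrence shows that
    5 qbar_n w is the imaginary part of z^(n+1) Phi_(n+1)(z^2)/Phi_0(z^2): a
    sine series that starts at sin((n + 1) t).  In its integral against
    p(c) |dc|, with |dc| = sin t dt, the factor p(c) sin t only involves
    sin(k t) with k <= deg p + 1, so the integral is 0 if deg p < n; if
    deg p = n, exactly one term survives, and it has the sign of the leading
    coefficient of p.  This gives orthogonality and positive norms.  The
    argument is carried out on moments ([msol_moment_qbar]), where every sum is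
    finite because polynomials have only finitely many nonzero sine
    coefficients; the sine functions appear as sin(m t) = sqrt(1 - c^2) U(c)
    with U a Chebyshev polynomial.

    What remains is w >= 0 and the convergence of its series.  The
    coefficients of Phi_0 after the first are negative, whence s_j <= 0 for
    j >= 1 ([weight_coefS_le0]).  As |sin((2 j + 1) t)| <= (2 j + 1) sin t, both
    follow if all partial sums of sum_j (2 j + 1) s_j are nonnegative
    ([psum_weight_coef_ge0]).  The full sum is 0, so that estimates have no
    room; but the partial sums of sum_j (4 j + 1) msol_(0,j) and
    sum_j (4 j + 3) msol_(1,j) have closed forms, and the product rule applied
    to Phi_1 = Phi_0 (Phi_1/Phi_0) transfers their signs. *)

(** * Cauchy products of sequences *)

Section Convolution.
Variable R : comNzRingType.
Implicit Types a b c : nat -> R.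

Definition conv a b (n : nat) : R := \sum_(i < n.+1) a i * b (n - i)%N.

(** Truncating to polynomials lets the ring structure of polynomials supply
    commutativity and associativity. *)
Lemma conv_coef a b n N : (n < N)%N ->
  conv a b n = ((\poly_(i < N) a i) * (\poly_(i < N) b i))`_n.
Proof.
move=> nN; rewrite coefM; apply: eq_bigr => i _.
have iN : (i < N)%N by apply: leq_ltn_trans nN; rewrite -ltnS.
by rewrite !coef_poly iN (leq_ltn_trans (leq_subr _ _) nN).
Qed.

Lemma convC a b : conv a b =1 conv b a.
Proof. by move=> n; rewrite !(conv_coef _ _ (ltnSn n)) mulrC. Qed.

Lemma convA a b c : conv a (conv b c) =1 conv (conv a b) c.
Proof.
move=> n; have le_n (i : 'I_n.+1) : (n - i < n.+1)%N by rewrite ltnS leq_subr.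
transitivity ((\poly_(i < n.+1) a i *
    (\poly_(i < n.+1) b i * \poly_(i < n.+1) c i))`_n).
  rewrite coefM; apply: eq_bigr => i _.
  by rewrite coef_poly ltn_ord (conv_coef _ _ (le_n i)).
rewrite mulrA coefM; apply: eq_bigr => i _.
by rewrite coef_poly le_n (conv_coef _ _ (ltn_ord i)).
Qed.

Lemma eq_convr a b b' : b =1 b' -> conv a b =1 conv a b'.
Proof. by move=> E n; apply: eq_bigr => i _; rewrite E. Qed.

Lemma eq_convl a a' b : a =1 a' -> conv a b =1 conv a' b.
Proof. by move=> E n; apply: eq_bigr => i _; rewrite E. Qed.

Lemma conv_at0 a b : conv a b 0%N = a 0%N * b 0%N.
Proof. by rewrite /conv big_ord1. Qed.

Lemma conv1 b : conv (fun n => (n == 0%N)%:R) b =1 b.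
Proof.
move=> n; rewrite /conv big_ord_recl subn0 mul1r big1 ?addr0 // => i _.
by rewrite mul0r.
Qed.

Definition psum a (n : nat) : R := \sum_(i < n.+1) a i.

Lemma psum_conv a : psum a =1 conv a (fun=> 1).
Proof. by move=> n; apply: eq_bigr => i _; rewrite mulr1. Qed.

(** Taking partial sums is multiplication by the series 1/(1 - u), hence it can
    be moved to either factor of a product. *)
Lemma psum_convl a b : psum (conv a b) =1 conv (psum a) b.
Proof.
move=> n; rewrite psum_conv -convA (eq_convr _ (convC _ _)) convA.
by apply: eq_convl => m; rewrite psum_conv.
Qed.

Lemma psum_convr a b : psum (conv a b) =1 conv a (psum b).
Proof.
move=> n; rewrite psum_conv -convA.
by apply: eq_convr => m; rewrite psum_conv.
Qed.

(** The hypothesis is the coefficientwise form of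
    x (1 + u) b(u) = y u t(u) + z b'(u), an identity which survives
    multiplication by the series a(u). *)
Lemma conv_shift_rec a b b' x y z t (n : nat) :
  (forall j, x * (b j.+1 + b j) = y * t j + z * b' j.+1) ->
  x * b 0%N = z * b' 0%N ->
  x * (conv a b n.+1 + conv a b n) = y * conv a t n + z * conv a b' n.+1.
Proof.
move=> H H0; rewrite /conv !(big_ord_recr n.+1) /= subnn !mulrDr.
rewrite (mulrCA x) H0 (mulrCA z) addrAC addrA; congr (_ + _).
rewrite !mulr_sumr -!big_split /=; apply: eq_bigr => i _.
have -> : (n.+1 - i = (n - i).+1)%N by rewrite subSn // -ltnS.
rewrite (mulrCA x) (mulrCA x) (mulrCA y) (mulrCA z) -!mulrDr.
by congr (_ * _); rewrite -H mulrDr.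
Qed.

(** Each coefficient of an inverse series depends on all the preceding ones, so
    the recursion builds the list of the first n + 1 of them. *)
Fixpoint inv_list c (n : nat) : seq R :=
  if n is n'.+1 then
    let l := inv_list c n' in
    rcons l (- \sum_(i < n) l`_i * c (n - i)%N)
  else [:: 1].

Definition inv_seq c (n : nat) : R := (inv_list c n)`_n.

Lemma size_inv_list c n : size (inv_list c n) = n.+1.
Proof. by elim: n => //= n IH; rewrite size_rcons IH. Qed.

Lemma nth_inv_list c n i : (i <= n)%N -> (inv_list c n)`_i = inv_seq c i.
Proof.
elim: n => [|n IH]; first by case: i.
rewrite leq_eqVlt => /predU1P[-> //|ltin].
by rewrite /= nth_rcons size_inv_list ltin IH.
Qed.

Lemma inv_seqP c : c 0%N = 1 ->
  conv (inv_seq c) c =1 (fun n => (n == 0%N)%:R).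
Proof.
move=> c0 [|n]; first by rewrite conv_at0 c0 mulr1.
rewrite /conv big_ord_recr /= subnn c0 mulr1 {2}/inv_seq /=.
rewrite nth_rcons size_inv_list ltnn eqxx.
rewrite [X in X - _](eq_bigr (fun i :
  'I_n.+1 => (inv_list c n)`_i * c (n.+1 - i)%N)) ?subrr //.
by move=> i _; rewrite nth_inv_list // -ltnS.
Qed.

End Convolution.
Arguments psum {R} a n.

(** * The minimal solution and the coefficients of the weight *)

Section Coefficients.
Variable R : realFieldType.

(** The coefficients (-1/2)_j / j! of the binomial series of sqrt(1 - u). *)
Fixpoint sqrt_coef (j : nat) : R :=
  if j is j'.+1 then sqrt_coef j' * (j'%:R - 1 / 2) / j'.+1%:R else 1.

(** The ratio of rising factorials (1/2)_m / (2)_m. *)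
Fixpoint poch_ratio (m : nat) : R :=
  if m is m'.+1 then poch_ratio m' * (m'%:R + 1 / 2) / m'.+2%:R else 1.

(** The coefficient of u^j in Phi_N(u); the factor (1/2)_N / (2)_N in front of
    2F1(-1/2, N + 1/2; N + 2; u) is what makes it depend on N + j only through
    [poch_ratio]. *)
Definition msol (N j : nat) : R := sqrt_coef j * poch_ratio (N + j).

(** The coefficients of the power series Phi_N/Phi_0. *)
Definition msol_ratio : nat -> nat -> R :=
  fun N => conv (inv_seq (msol 0)) (msol N).

Lemma poch_ratio_gt0 m : 0 < poch_ratio m.
Proof.
elim: m => //= m IH; apply: divr_gt0; last by rewrite ltr0n.
by apply: mulr_gt0 => //; have := ler0n R m; lra.
Qed.

Lemma sqrt_coefS_lt0 j : sqrt_coef j.+1 < 0.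
Proof.
elim: j => [|j IH]; first by rewrite /=; lra.
have -> : sqrt_coef j.+2 = sqrt_coef j.+1 * (j.+1%:R - 1 / 2) / j.+2%:R by [].
rewrite pmulr_llt0 ?invr_gt0 ?ltr0n // nmulr_rlt0 //.
by rewrite -addn1 natrD; have := ler0n R j; lra.
Qed.

Lemma msolS_lt0 N j : msol N j.+1 < 0.
Proof. by rewrite /msol pmulr_llt0 ?sqrt_coefS_lt0 ?poch_ratio_gt0. Qed.

(** With c = (z + 1/z)/2 and u = z^2, the recurrence for z^N Phi_N(u) becomes
    (N+1)(1 + u) Phi_N = (N + 5/2) u Phi_(N+1) + (N - 1/2) Phi_(N-1), here with
    N + 1 in place of N. *)
Lemma msol_rec N j :
  N.+2%:R * (msol N.+1 j.+1 + msol N.+1 j) =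
  (N.+1%:R + 5 / 2) * msol N.+2 j + (N.+1%:R - 1 / 2) * msol N j.+1.
Proof.
rewrite /msol; set b := poch_ratio (N + j.+1).
have -> : poch_ratio (N.+1 + j) = b by rewrite /b addSnnS.
have -> : poch_ratio (N.+1 + j.+1) =
  b * ((N + j.+1)%:R + 1 / 2) / (N + j.+1).+2%:R by [].
have -> : poch_ratio (N.+2 + j) =
  b * ((N + j.+1)%:R + 1 / 2) / (N + j.+1).+2%:R.
  by rewrite !addSn -addnS.
have -> : sqrt_coef j.+1 = sqrt_coef j * (j%:R - 1 / 2) / j.+1%:R by [].
have j0 := ler0n R j; have N0 := ler0n R N.
rewrite -[j.+1]addn1 -[(N + _).+2]addn2 -[N.+2]addn2 -[N.+1]addn1 !natrD.
field; rewrite !lt0r_neq0 //; lra.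
Qed.

Lemma msol_rec0 N : N.+2%:R * msol N.+1 0%N = (N.+1%:R - 1 / 2) * msol N 0%N.
Proof.
rewrite /msol /= !addn0 /= !mul1r.
have N0 := ler0n R N; rewrite -[N.+2]addn2 -[N.+1]addn1 !natrD.
by field; rewrite lt0r_neq0 //; lra.
Qed.

Lemma msol_ratio_rec N j :
  N.+2%:R * (msol_ratio N.+1 j.+1 + msol_ratio N.+1 j) =
  (N.+1%:R + 5 / 2) * msol_ratio N.+2 j + (N.+1%:R - 1 / 2) * msol_ratio N j.+1.
Proof. exact: (conv_shift_rec _ _ (msol_rec N) (msol_rec0 N)). Qed.

Lemma inv_seq_msol0 : inv_seq (msol 0) 0%N = 1. Proof. by []. Qed.

Lemma msol_ratio_rec0 N : N.+2%:R * msol_ratio N.+1 0%N =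
  (N.+1%:R - 1 / 2) * msol_ratio N 0%N.
Proof.
by rewrite /msol_ratio !conv_at0 !(mulrCA _ (inv_seq _ _)) msol_rec0.
Qed.

Lemma msol_ratio_0 j : msol_ratio 0 j = (j == 0%N)%:R.
Proof. by rewrite /msol_ratio inv_seqP // /msol mulr1. Qed.

Lemma msol_ratio0_gt0 N : 0 < msol_ratio N 0%N.
Proof. by rewrite /msol_ratio conv_at0 /msol !mul1r poch_ratio_gt0. Qed.

Definition weight_coef : nat -> R := msol_ratio 1.

Lemma conv_msol0_weight_coef : conv (msol 0) weight_coef =1 msol 1.
Proof.
move=> n; rewrite /weight_coef /msol_ratio convA -[RHS]conv1;
  apply: eq_convl => m.
by rewrite convC inv_seqP // /msol mulr1.
Qed.

Lemma msol00 : msol 0 0%N = 1. Proof. by rewrite /msol mulr1. Qed.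

Lemma weight_coef0 : weight_coef 0%N = 1 / 4.
Proof.
by rewrite /weight_coef /msol_ratio conv_at0 inv_seq_msol0 /msol /=; field.
Qed.

Lemma msol1E n : msol 1 n = msol 0 n * (n%:R + 1 / 2) / n.+2%:R.
Proof. by rewrite /msol /= !mulrA. Qed.

Lemma msol0S n :
  msol 0 n.+1 = msol 0 n * (n%:R ^+ 2 - 1 / 4) / (n.+1%:R * n.+2%:R).
Proof.
rewrite /msol !add0n /=; have n0 := ler0n R n.
rewrite -[n.+2]addn2 -[n.+1]addn1 !natrD.
by field; rewrite !lt0r_neq0 //; lra.
Qed.

(** The series sum_j (4 j + 1) msol_(0,j) telescopes: 4 Phi_0'(1) + Phi_0(1) = 0
    by the hypergeometric equation at its singular point u = 1. *)
Lemma psum_msol0 N :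
  psum (fun n => (4 * n%:R + 1) * msol 0 n) N = (1 - 4 * N%:R ^+ 2) * msol 0 N.
Proof.
elim: N => [|N IH]; first by rewrite /psum big_ord1 /=; ring.
rewrite /psum big_ord_recr /= [X in X + _]IH msol0S; have n0 := ler0n R N.
rewrite -[N.+2]addn2 -[N.+1]addn1 !natrD.
by field; rewrite !lt0r_neq0 //; lra.
Qed.

(** The same for Phi_1, where 4 Phi_1'(1) + 3 Phi_1(1) = 0. *)
Lemma psum_msol1 N :
  psum (fun n => (4 * n%:R + 3) * msol 1 n) N =
  (1 - 2 * N%:R) * (2 * N%:R + 3) * msol 1 N.
Proof.
elim: N => [|N IH]; first by rewrite /psum big_ord1 /=; ring.
rewrite /psum big_ord_recr /= [X in X + _]IH !msol1E msol0S;
  have n0 := ler0n R N.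
rewrite -[N.+3]addn3 -[N.+2]addn2 -[N.+1]addn1 !natrD.
by field; rewrite !lt0r_neq0 //; lra.
Qed.

Lemma psum_msol0_ge0 N : 0 <= psum (fun n => (4 * n%:R + 1) * msol 0 n) N.
Proof.
rewrite psum_msol0; case: N => [|N].
  by rewrite msol00; lra.
apply: mulr_le0; last exact/ltW/msolS_lt0.
by rewrite -addn1 natrD; have := ler0n R N; nra.
Qed.

Lemma psum_msol1_ge N :
  psum (fun n => (4 * n%:R + 1) * msol 0 n) N * (1 / 4) <=
  psum (fun n => (4 * n%:R + 3) * msol 1 n) N.
Proof.
have -> : psum (fun n => (4 * n%:R + 3) * msol 1 n) N =
  psum (fun n => (4 * n%:R + 1) * msol 0 n) N *
    ((2 * N%:R + 3) / (2 * N.+2%:R)).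
  rewrite psum_msol0 psum_msol1 msol1E; have n0 := ler0n R N.
  rewrite -[N.+2]addn2 natrD.
  by field; rewrite !lt0r_neq0 //; lra.
apply: ler_wpM2l; first exact: psum_msol0_ge0.
have n0 := ler0n R N.
by rewrite -[N.+2]addn2 natrD ler_pdivlMr; lra.
Qed.

Lemma weight_coef_rec n :
  weight_coef n.+1 = (msol 1 n.+1 - msol 0 n.+1 / 4)
     - \sum_(i < n) msol 0 i.+1 * weight_coef (n - i)%N.
Proof.
have := conv_msol0_weight_coef n.+1.
rewrite /conv big_ord_recl big_ord_recr /= subnn weight_coef0 msol00 subn0
  mul1r => <-.
rewrite (eq_bigr (fun i : 'I_n => msol 0 i.+1 * weight_coef (n - i)%N));
  first by ring.
by move=> i _.
Qed.

(** In [weight_coef_rec] every product in the sum has two nonpositive factors,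
    and the remaining term is a positive multiple of a coefficient of Phi_0. *)
Lemma weight_coefS_le0 n : weight_coef n.+1 <= 0.
Proof.
elim/ltn_ind: n => n IH; rewrite weight_coef_rec.
have h1 : msol 1 n.+1 - msol 0 n.+1 / 4 <= 0.
  rewrite msol1E -mulrA -mulrBr; apply: mulr_le0_ge0; first exact/ltW/msolS_lt0.
  rewrite subr_ge0 ler_pdivlMr ?ltr0n //; have := ler0n R n.
  by rewrite -[n.+3]addn3 -[n.+1]addn1 !natrD; lra.
have h2 : 0 <= \sum_(i < n) msol 0 i.+1 * weight_coef (n - i)%N.
  apply: sumr_ge0 => i _; apply: mulr_le0; first exact/ltW/msolS_lt0.
  have -> : (n - i = (n - i.+1).+1)%N by rewrite subnSK.
  by apply: IH; rewrite ltn_subrL /= (leq_trans _ (ltn_ord i)).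
lra.
Qed.

(** The product rule for the Euler operator u d/du: the weight 4 n + 3 splits as
    (4 k + 1) + 2 (2 (n - k) + 1). *)
Lemma euler_weight_coef_conv n :
  (4 * n%:R + 3) * msol 1 n =
  conv (fun k => (4 * k%:R + 1) * msol 0 k) weight_coef n
  + 2 * conv (msol 0) (fun k => (2 * k%:R + 1) * weight_coef k) n.
Proof.
rewrite -conv_msol0_weight_coef /conv !mulr_sumr -big_split /=;
  apply: eq_bigr => i _.
by rewrite natrB -1?ltnS //; ring.
Qed.

(** Summing [euler_weight_coef_conv] gives B = C * s + 2 Phi_0 * A, where
    A, B, C are the partial sums of (2 j + 1) s_j, (4 j + 3) msol_(1,j) and
    (4 j + 1) msol_(0,j).  Since C >= 0 and s_j <= 0 for j >= 1, the product
    C * s is at most C_N s_0 = C_N / 4, which is at most B_N; the negative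
    coefficients of Phi_0 then propagate A >= 0 by strong induction. *)
Lemma psum_weight_coef_ge0 N :
  0 <= psum (fun n => (2 * n%:R + 1) * weight_coef n) N.
Proof.
elim/ltn_ind: N => N IH.
set A := psum _ in IH *.
pose C := psum (fun n => (4 * n%:R + 1) * msol 0 n).
have E : psum (fun n => (4 * n%:R + 3) * msol 1 n) N =
         conv C weight_coef N + 2 * conv (msol 0) A N.
  rewrite -psum_convl -psum_convr /psum mulr_sumr -big_split /=.
  by apply: eq_bigr => i _; rewrite euler_weight_coef_conv.
have hC : conv C weight_coef N <= C N * (1 / 4).
  rewrite /conv big_ord_recr /= subnn weight_coef0 gerDr.
  apply: sumr_le0 => i _; apply: mulr_ge0_le0; first exact: psum_msol0_ge0.
  have -> : (N - i = (N - i.+1).+1)%N by rewrite subnSK.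
  exact: weight_coefS_le0.
have hA : conv (msol 0) A N <= A N.
  rewrite /conv big_ord_recl /= subn0 msol00 mul1r gerDl.
  apply: sumr_le0 => i _; apply: mulr_le0_ge0; first exact/ltW/msolS_lt0.
  by apply: IH; rewrite ltn_subrL /= (leq_trans _ (ltn_ord i)).
have := psum_msol1_ge N; rewrite E -/C; lra.
Qed.

Lemma sum_norm_weight_coef_le n :
  \sum_(j < n) (2 * j%:R + 1) * `|weight_coef j| <= 1 / 2.
Proof.
case: n => [|n]; first by rewrite big_ord0; lra.
have := psum_weight_coef_ge0 n; rewrite /psum !big_ord_recl /= weight_coef0.
rewrite ger0_norm; last by lra.
rewrite [X in _ -> _ + X <= _](eq_bigr
  (fun i : 'I_n => - ((2 * (lift ord0 i)%:R + 1) * weight_coef (lift ord0 i)))).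
  by rewrite sumrN; lra.
by move=> i _; rewrite ler0_norm ?mulrN //; exact: weight_coefS_le0.
Qed.

End Coefficients.

(** * Sine functions in the variable c = cos t *)

Section Chebyshev.
Local Open Scope classical_set_scope.
Local Open Scope ring_scope.
Variable R : realType.
Local Notation mu := (@lebesgue_measure R).
Local Notation I := (`[(-1 : R), 1]%classic).

(** The Chebyshev polynomials of the second kind, shifted by one so that
    sin(m t) = sin t * (chebU m)(cos t) and [chebU 0] is 0. *)
Fixpoint chebU (m : nat) : {poly R} :=
  match m with
  | m1.+1 => match m1 with
             | m2.+1 => 2 *: ('X * chebU m1) - chebU m2
             | 0 => 1
             end
  | 0 => 0
  end.

(** The square root of a negative number being 0, this function vanishes
    outside [-1, 1]; inside it is sin(m t) at c = cos t ([chebV_sin]). *)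
Definition chebV (m : nat) (x : R) : R := Num.sqrt (1 - x ^+ 2) * (chebU m).[x].

Lemma chebV_rec m x : 2 * x * chebV m.+1 x = chebV m.+2 x + chebV m x.
Proof.
rewrite /chebV; have -> : chebU m.+2 = 2 *: ('X * chebU m.+1) - chebU m by [].
by rewrite hornerD hornerN hornerZ hornerM hornerX; ring.
Qed.

Lemma chebV0 x : chebV 0 x = 0.
Proof. by rewrite /chebV horner0 mulr0. Qed.

Lemma chebV1 x : chebV 1 x = Num.sqrt (1 - x ^+ 2).
Proof. by rewrite /chebV hornerC mulr1. Qed.

Lemma chebV_sin m x : -1 <= x <= 1 -> chebV m x = sin (m%:R * acos x).
Proof.
move=> x1; suff : chebV m x = sin (m%:R * acos x) /\
    chebV m.+1 x = sin (m.+1%:R * acos x) by case.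
elim: m => [|m [IH0 IH1]].
  by rewrite chebV0 mul0r sin0 chebV1 mul1r sin_acos.
split => //; have := chebV_rec m x; rewrite IH0 IH1.
have {1}-> : x = cos (acos x) by rewrite acosK.
have -> : m%:R * acos x = m.+1%:R * acos x - acos x.
  by rewrite -addn1 natrD; ring.
have -> : m.+2%:R * acos x = m.+1%:R * acos x + acos x.
  by rewrite -(addn1 m.+1) natrD; ring.
by rewrite sinB sinD; lra.
Qed.

Lemma chebV_out m x : ~~ (-1 <= x <= 1) -> chebV m x = 0.
Proof.
move=> nx; rewrite /chebV ler0_sqrtr ?mul0r // subr_le0 leNgt.
apply: contra nx => x1; rewrite -ler_norml -(@ler_pXn2r _ 2) ?nnegrE //.
by rewrite expr1n real_normK ?num_real // ltW.
Qed.

Lemma norm_sin_mulrn (m : nat) (t : R) : `|sin (m%:R * t)| <= m%:R * `|sin t|.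
Proof.
elim: m => [|m IH]; first by rewrite !mul0r sin0 normr0.
rewrite -addn1 natrD !mulrDl !mul1r sinD (le_trans (ler_normD _ _)) // lerD //.
  by rewrite normrM (le_trans _ IH) // ler_piMr // cos_max.
by rewrite normrM ler_piMl // cos_max.
Qed.

Lemma chebV_le m x : `|chebV m x| <= m%:R * chebV 1 x.
Proof.
have [x1|nx] := boolP (-1 <= x <= 1); last by rewrite !chebV_out ?normr0 ?mulr0.
rewrite chebV_sin // (le_trans (norm_sin_mulrn _ _)) // sin_acos // chebV1.
by rewrite ger0_norm // sqrtr_ge0.
Qed.

Lemma chebV_le1 m x : `|chebV m x| <= 1.
Proof.
have [x1|nx] := boolP (-1 <= x <= 1); last by rewrite chebV_out ?normr0.
by rewrite chebV_sin // sin_max.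
Qed.

Lemma chebV1_ge0 x : 0 <= chebV 1 x.
Proof. by rewrite chebV1 sqrtr_ge0. Qed.

Lemma continuous_chebV m : continuous (chebV m).
Proof.
move=> x; apply: cvgM; last exact: continuous_horner.
apply: (@continuous_comp _ _ _ (fun x : R => 1 - x ^+ 2) Num.sqrt);
  last exact: sqrt_continuous.
by apply: cvgB; [exact: cvg_cst|exact: exprn_continuous].
Qed.

Lemma is_derive_chebV m (x : R) : -1 < x < 1 ->
  is_derive x 1 (chebV m) (- (m%:R * cos (m%:R * acos x)) / Num.sqrt (1 - x ^+
    2)).
Proof.
move=> x1; apply: (@near_eq_is_derive _ _ _ (fun y => sin (m%:R * acos y))).
  have xI : x \in `]-1, 1[ by rewrite in_itv.
  near=> y; rewrite chebV_sin //.
  have : y \in `]-1, 1[ by near: y; exact: near_in_itvoo.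
  by rewrite in_itv /= => /andP[/ltW -> /ltW ->].
have Da := is_derive1_acos x1.
apply: (@is_derive_eq _ _ _ _ _ _ _ _ (is_derive1_comp _ _)).
by rewrite /GRing.scale /=; ring.
Unshelve. all: by end_near.
Qed.

(** With dc = - sin t dt, a primitive of sin(m t) is
    (sin((m+1) t)/(m+1) - sin((m-1) t)/(m-1)) / 2, which vanishes at both
    endpoints. *)
Lemma itv_int_chebV m : (2 <= m)%N -> \int[mu]_(x in I) chebV m x = 0.
Proof.
case: m => [//|[//|m]] _.
pose F := (2 * m.+3%:R)^-1 \*: chebV m.+3 - (2 * m.+1%:R)^-1 \*: chebV m.+1.
have dF (x : R) : -1 < x < 1 -> is_derive x 1 F (chebV m.+2 x).
  move=> x1; have D3 := is_derive_chebV m.+3 x1.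
  have D1 := is_derive_chebV m.+1 x1.
  apply: is_derive_eq.
  have -> : chebV m.+2 x = sin (m.+2%:R * acos x).
    by rewrite chebV_sin //; case/andP: x1 => /ltW -> /ltW ->.
  have -> : m.+3%:R * acos x = m.+2%:R * acos x + acos x.
    by rewrite -[m.+3]addn1 natrD; ring.
  have -> : m.+1%:R * acos x = m.+2%:R * acos x - acos x.
    by rewrite -[m.+2]addn1 natrD; ring.
  have s0 : Num.sqrt (1 - x ^+ 2) != 0.
    by rewrite lt0r_neq0 // sqrtr_gt0; case/andP: x1 => *; nra.
  rewrite cosD cosB sin_acos; last by case/andP: x1 => /ltW -> /ltW ->.
  have m0 := ler0n R m.
  rewrite /GRing.scale /= -[m.+3]addn3 -[m.+1]addn1 !natrD.
  by field; rewrite s0 !lt0r_neq0 //; lra.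
have cF : continuous F.
  by move=> x; apply: continuousB; apply: continuousZl_tmp;
    exact: continuous_chebV.
rewrite /Rintegral (@continuous_FTC2 _ (chebV m.+2) F).
- by rewrite /F !fctE /= /chebV expr1n sqrrN expr1n subrr sqrtr0 !mul0r
  !scaler0 !subr0.
- by lra.
- by apply: continuous_subspaceT => x; exact: continuous_chebV.
- split.
  + by move=> x; rewrite in_itv /= => /dF[].
  + by apply: cvg_at_right_filter; exact: cF.
  + by apply: cvg_at_left_filter; exact: cF.
- by move=> x; rewrite in_itv /= => /dF [_ <-]; rewrite derive1E.
Qed.

(** Only the sign of this integral matters (its value is pi/2); it comes from
    sqrt v >= v for v = 1 - c^2 in [0, 1]. *)
Lemma itv_int_chebV1_gt0 : 0 < \int[mu]_(x in I) chebV 1 x.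
Proof.
pose p : {poly R} := 1 - 'X^2; pose P : {poly R} := 'X - 3^-1 *: 'X^3.
have dP : P^`() = p.
  rewrite /P derivB derivX derivZ derivXn /p; congr (_ - _).
  by rewrite -scalerMnr scalerMnl -mulr_natr mulVf ?scale1r.
have ip : \int[mu]_(x in I) p.[x] = 4 / 3.
  rewrite /Rintegral (@continuous_FTC2 _ (horner p) (horner P)).
  - by rewrite -EFinB /= /P !hornerE /=; field.
  - by lra.
  - by apply: continuous_subspaceT => x; exact: continuous_horner.
  - split.
    + by move=> x _; exact: derivable_horner.
    + by apply: cvg_at_right_filter; exact: continuous_horner.
    + by apply: cvg_at_left_filter; exact: continuous_horner.
  - by move=> x _; rewrite -derivE dP.
apply: (@lt_le_trans _ _ (\int[mu]_(x in I) p.[x])); first by rewrite ip; lra.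
apply: le_Rintegral => //.
- by apply: continuous_compact_integrable; [exact: segment_compact|];
    apply: continuous_subspaceT => x; exact: continuous_horner.
- by apply: continuous_compact_integrable; [exact: segment_compact|];
    apply: continuous_subspaceT => x; exact: continuous_chebV.
move=> x; rewrite /= in_itv /= => /andP[x0 x1].
have u0 : 0 <= 1 - x ^+ 2 by nra.
rewrite chebV1 /p !hornerE /=.
have s0 := sqrtr_ge0 (1 - x ^+ 2); have ss := sqr_sqrtr u0.
have : 1 - x ^+ 2 <= 1 by nra.
rewrite -{1}ss; nra.
Qed.

Lemma integrable_horner_chebV (p : {poly R}) m :
  mu.-integrable I (EFin \o (fun x => p.[x] * chebV m x)).
Proof.
apply: continuous_compact_integrable; first exact: segment_compact.
apply: continuous_subspaceT => x.
by apply: cvgM; [exact: continuous_horner|exact: continuous_chebV].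
Qed.

End Chebyshev.

(** * Moments of the minimal solution *)

Section Moments.
Local Open Scope classical_set_scope.
Local Open Scope ring_scope.
Variable R : realType.
Local Notation mu := (@lebesgue_measure R).
Local Notation I := (`[(-1 : R), 1]%classic).
Implicit Types p q : {poly R}.

Definition cheb_moment p m : R := \int[mu]_(x in I) (p.[x] * chebV m x).

Lemma cheb_momentD p q m : cheb_moment (p + q) m =
  cheb_moment p m + cheb_moment q m.
Proof.
rewrite /cheb_moment -RintegralD //; try exact: integrable_horner_chebV.
by apply: eq_Rintegral => x _; rewrite hornerD mulrDl.
Qed.

Lemma cheb_momentZ a p m : cheb_moment (a *: p) m = a * cheb_moment p m.
Proof.
rewrite /cheb_moment -RintegralZl //; last exact: integrable_horner_chebV.
by apply: eq_Rintegral => x _; rewrite hornerZ -mulrA.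
Qed.

Lemma cheb_moment_mulX p m : 2 * cheb_moment ('X * p) m.+1 =
  cheb_moment p m.+2 + cheb_moment p m.
Proof.
rewrite /cheb_moment -RintegralD //; try exact: integrable_horner_chebV.
rewrite -RintegralZl //; last exact: integrable_horner_chebV.
apply: eq_Rintegral => x _; rewrite hornerM hornerX -mulrDr -chebV_rec.
by ring.
Qed.

Lemma cheb_moment0 p : cheb_moment p 0 = 0.
Proof.
rewrite /cheb_moment (@eq_Rintegral _ _ _ mu I (fun=> 0));
  first by rewrite /Rintegral integral0.
move=> x _.
by rewrite chebV0 mulr0.
Qed.

Lemma cheb_momentC c m : cheb_moment c%:P m = c * \int[mu]_(x in I) chebV m x.
Proof.
rewrite -[c%:P]mulr1 mul_polyC cheb_momentZ; congr (_ * _).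
by apply: eq_Rintegral => x _; rewrite hornerC mul1r.
Qed.

(** By [cheb_moment_mulX] each factor X moves the index m by one, so a
    polynomial of degree at most m connects sin((m + 1) t) to sin t only through
    its monomial X^m. *)
Lemma cheb_moment_lead p m : (size p <= m.+1)%N ->
  cheb_moment p m.+1 = p`_m / 2 ^+ m * \int[mu]_(x in I) chebV 1 x.
Proof.
elim/poly_ind: p m => [|p c IH] m sp.
  by rewrite -{1}(scale0r (0 : {poly R})) cheb_momentZ coef0 !mul0r.
have sp' : (size p <= m)%N.
  move: sp; rewrite -[p * 'X + _]cons_poly_def size_cons_poly.
  by case: ifP => // /andP[/nilP -> _].
apply: (mulfI (_ : 2 != 0 :> R)) => //.
rewrite cheb_momentD cheb_momentC [p * 'X]mulrC mulrDr cheb_moment_mulX.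
rewrite (IH m.+1) //; last exact: leq_trans sp' (leqW (leqnSn _)).
rewrite nth_default ?(leq_trans sp') // !mul0r add0r.
rewrite coefD coefXM coefC.
case: m sp sp' => [|m] sp sp' /=.
  by rewrite cheb_moment0 expr0 add0r; field.
rewrite (IH m) // (itv_int_chebV R (m := m.+2)) // exprS; field.
by rewrite expf_neq0.
Qed.

(** The integral of p against the sine series with coefficients Phi_N/Phi_0,
    truncated after K terms; by [cheb_moment_small] all K >= size p give the
    same value, which makes convergence irrelevant here. *)
Definition msol_moment (K N : nat) p : R :=
  \sum_(j < K) msol_ratio R N j * cheb_moment p (N + 2 * j).

Lemma msol_momentD K N p q : msol_moment K N (p + q) =
  msol_moment K N p + msol_moment K N q.
Proof.
by rewrite /msol_moment -big_split /=; apply: eq_bigr => j _;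
  rewrite cheb_momentD mulrDr.
Qed.

Lemma msol_momentZ K N a p : msol_moment K N (a *: p) = a * msol_moment K N p.
Proof.
by rewrite /msol_moment mulr_sumr; apply: eq_bigr => j _;
  rewrite cheb_momentZ mulrCA.
Qed.

(** Phi_0/Phi_0 = 1 leaves only the index m = 0, and sin(0 t) = 0. *)
Lemma msol_moment0 K p : msol_moment K 0 p = 0.
Proof.
rewrite /msol_moment big1 // => -[[|j] jK] _;
  first by rewrite cheb_moment0 mulr0.
by rewrite msol_ratio_0 mul0r.
Qed.

Lemma cheb_moment_small p m : (size p <= m)%N -> cheb_moment p m.+1 = 0.
Proof.
by move=> sp; rewrite cheb_moment_lead ?leqW // nth_default // !mul0r.
Qed.

(** The bound on the size of p makes the boundary term of the truncation
    vanish. *)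
Lemma msol_moment_rec K N p : (size p < K)%N ->
  2 * N.+2%:R * msol_moment K N.+1 ('X * p) =
  (N.+1%:R + 5 / 2) * msol_moment K N.+2 p +
    (N.+1%:R - 1 / 2) * msol_moment K N p.
Proof.
case: K => // K; rewrite ltnS => sp.
have -> : 2 * N.+2%:R * msol_moment K.+1 N.+1 ('X * p) =
  \sum_(j < K.+1) N.+2%:R * msol_ratio R N.+1 j * cheb_moment p (N.+2 + 2 * j)
  + \sum_(j < K.+1) N.+2%:R * msol_ratio R N.+1 j * cheb_moment p (N + 2 * j).
  rewrite /msol_moment mulr_sumr -big_split /=; apply: eq_bigr => j _.
  rewrite -mulrDr !addSn -cheb_moment_mulX; ring.
rewrite /msol_moment big_ord_recr /= [X in _ + X = _]big_ord_recl /=.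
rewrite [X in _ = _ * X + _]big_ord_recr /= [X in _ = _ + _ * X]big_ord_recl /=.
rewrite !addSn !(cheb_moment_small (p:=p)) ?mulr0 ?addr0; last 1 first.
  by rewrite (leq_trans sp) // mul2n -addnn addnA leqW // leq_addl.
rewrite msol_ratio_rec0 -!mulrA mulrDr !mulr_sumr addrCA [RHS]addrCA;
  congr (_ + _).
rewrite -!big_split /=; apply: eq_bigr => j _.
have -> : (N + 2 * bump 0 j =
  (N + 2 * j).+2)%N by rewrite /bump /= mulnDr addnCA.
have := msol_ratio_rec R N j; rewrite /bump /= add1n => E.
rewrite !mulrA -!mulrDl -mulrDr.
by rewrite [msol_ratio R N.+1 j + _]addrC E.
Qed.

Lemma qbarE n : qbar R n = P_shift R (2 * n + 6).
Proof. by rewrite /qbar /P_m2 -addrA -PoszM -PoszD absz_nat. Qed.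

Lemma P_shift_rec k : P_shift R k.+4 =
  (6 + 2 * k%:R)^-1 *: ((4 * k%:R) *: ('X * P_shift R k.+2)
         - (2 * (k%:R - 3)) *: P_shift R k).
Proof. by []. Qed.

Lemma P_shift4 : P_shift R 4 = 0.
Proof. by rewrite P_shift_rec /= !(mulr0, scale0r, scaler0, subr0). Qed.

Lemma qbar0 : qbar R 0 = 5^-1 *: 1.
Proof.
rewrite qbarE (P_shift_rec 2) P_shift4 mulr0 scaler0 sub0r -scaleNr scalerA.
by congr (_ *: _); field.
Qed.

Lemma qbar1 : qbar R 1 = (8 / 7) *: ('X * qbar R 0).
Proof.
rewrite !qbarE (P_shift_rec 4) P_shift4 scaler0 subr0 scalerA.
by congr (_ *: _); field.
Qed.

Lemma qbar_rec n : qbar R n.+2 =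
  (4 * (n%:R + 3) / (2 * n%:R + 9)) *: ('X * qbar R n.+1)
  + (- ((2 * n%:R + 3) / (2 * n%:R + 9))) *: qbar R n.
Proof.
have -> : qbar R n.+2 = P_shift R (2 * n + 6).+4.
  by rewrite qbarE; congr P_shift; ring.
have -> : qbar R n.+1 = P_shift R (2 * n + 6).+2.
  by rewrite qbarE; congr P_shift; ring.
have n0 := ler0n R n.
rewrite P_shift_rec -qbarE natrD natrM scalerBr !scalerA -scaleNr.
by congr (_ *: _ + _ *: _); field; rewrite ?lt0r_neq0 //; lra.
Qed.

(** In N, both sides satisfy the recurrence of the qbar_N and vanish at the
    index before the first; the factor 5 is 1 / qbar_0. *)
Lemma msol_moment_qbar N K p : (size p + N < K)%N ->
  msol_moment K N.+1 p = 5 * msol_moment K 1 (qbar R N * p).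
Proof.
suff: (forall p K, (size p + N < K)%N ->
        msol_moment K N.+1 p = 5 * msol_moment K 1 (qbar R N * p)) /\
      (forall p K, (size p + N.+1 < K)%N ->
        msol_moment K N.+2 p = 5 * msol_moment K 1 (qbar R N.+1 * p)) by move=>
          [H _]; exact: H.
elim: N {p K} => [|N [IH0 IH1]].
  have H0 p K : msol_moment K 1 p = 5 * msol_moment K 1 (qbar R 0 * p).
    by rewrite qbar0 -scalerAl mul1r msol_momentZ; field.
  split=> p K sp; first exact: H0.
  have := @msol_moment_rec K 0 p (leq_ltn_trans (leq_addr _ _) sp).
  have -> : qbar R 1 * p = (8 / 7) *: (qbar R 0 * ('X * p)).
    by rewrite qbar1 -mul_polyC -(mul_polyC _ (_ * _)); ring.
  rewrite msol_moment0 mulr0 addr0 (H0 ('X * p)) msol_momentZ.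
  lra.
split=> // p K sp.
have spK : (size p < K)%N by apply: leq_ltn_trans sp; exact: leq_addr.
have := msol_moment_rec N.+1 spK.
rewrite IH0; last by apply: leq_ltn_trans sp; rewrite leq_add2l !leqW.
rewrite IH1; last first.
  apply: leq_ltn_trans sp; rewrite -(addSnnS (size p)) leq_add2r.
  by rewrite (leq_trans (size_polyMleq _ _)) // size_polyX.
have -> : qbar R N.+2 * p =
    (4 * (N%:R + 3) / (2 * N%:R + 9)) *: (qbar R N.+1 * ('X * p))
    + (- ((2 * N%:R + 3) / (2 * N%:R + 9))) *: (qbar R N * p).
  by rewrite qbar_rec -!mul_polyC; ring.
rewrite msol_momentD !msol_momentZ; have n0 := ler0n R N.
rewrite -[N.+3]addn3 -[N.+2]addn2 !natrD => H.
set A := msol_moment K 1 _ in H *;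
  set B := msol_moment K 1 (qbar R N * p) in H *.
have d0 : 2 * N%:R + 9 != 0 :> R by rewrite lt0r_neq0 //; lra.
apply: (mulfI (_ : (2 * N%:R + 9) / 2 != 0 :> R)).
  by rewrite mulf_neq0 // invr_neq0.
transitivity (10 * (N%:R + 3) * A - 5 * ((2 * N%:R + 3) / 2) * B).
  by move: H; lra.
by field.
Qed.

End Moments.

(** * The weight *)

Section Weight.
Local Open Scope classical_set_scope.
Local Open Scope ring_scope.
Variable R : realType.
Local Notation mu := (@lebesgue_measure R).
Local Notation I := (`[(-1 : R), 1]%classic).
Implicit Types p q : {poly R}.

Definition partial_weight n (x : R) : R :=
  \sum_(j < n) weight_coef R j * chebV (1 + 2 * j) x.

Definition weight (x : R) : R := limn (partial_weight ^~ x).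

(** Since |sin((2 j + 1) t)| <= (2 j + 1) sin t and only s_0 is positive, each
    partial sum is at least sin t times a partial sum of (2 j + 1) s_j. *)
Lemma partial_weight_ge0 n x : 0 <= partial_weight n x.
Proof.
case: n => [|n]; first by rewrite /partial_weight big_ord0.
apply: (@le_trans _ _ (psum (fun j => (2 * j%:R +
  1) * weight_coef R j) n * chebV 1 x)).
  by rewrite mulr_ge0 ?psum_weight_coef_ge0 ?chebV1_ge0.
rewrite /psum mulr_suml /partial_weight; apply: ler_sum => -[[|j] jn] _ /=.
  by rewrite mulr0 add0r mul1r.
rewrite [_ * weight_coef R _]mulrC -mulrA ler_wnM2l ?weight_coefS_le0 //.
rewrite (le_trans (ler_norm _)) // (le_trans (chebV_le _ _)) //.
by rewrite natrD natrM addrC.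
Qed.

Lemma sum_norm_weight_le n x :
  \sum_(j < n) `|weight_coef R j * chebV (1 + 2 * j) x| <= 1 / 2.
Proof.
apply: le_trans (sum_norm_weight_coef_le R n); apply: ler_sum => j _.
rewrite normrM [leRHS]mulrC ler_wpM2l // (le_trans (chebV_le1 _ _)) //.
by rewrite lerDr mulr_ge0.
Qed.

Lemma cvg_partial_weight x : partial_weight n x @[n --> \oo] --> weight x.
Proof.
have E : partial_weight ^~ x =
  series (fun j => weight_coef R j * chebV (1 + 2 * j) x).
  by apply/funext => n; rewrite /series /= big_mkord.
rewrite /weight E; apply: normed_cvg; apply: nondecreasing_is_cvgn.
  by apply: nondecreasing_series => j _ _; rewrite normr_ge0.
exists (1 / 2) => _ [n _ <-]; rewrite /normed_series_of seriesEord.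
exact: sum_norm_weight_le.
Qed.

Lemma weight_ge0 x : 0 <= weight x.
Proof.
apply: (@limr_ge _ _ _ _ _ (partial_weight ^~ x)).
  exact: cvgP (cvg_partial_weight (x := x)).
by near=> n; exact: partial_weight_ge0.
Unshelve. all: by end_near.
Qed.

Lemma partial_weight_le n x : `|partial_weight n x| <= 1 / 2.
Proof.
exact: le_trans (ler_norm_sum _ _ _) (sum_norm_weight_le _ _).
Qed.

Lemma weight_out x : ~ I x -> weight x = 0.
Proof.
rewrite /= in_itv /= => /negP nx.
apply: cvg_lim => //; rewrite (_ : partial_weight ^~ x = fun=> 0);
  first exact: cvg_cst.
by apply/funext => n; rewrite /partial_weight big1 // => j _;
  rewrite chebV_out ?mulr0.
Qed.

Lemma int_partial_weight K p :
  (\int[mu]_(x in I) (p.[x] * partial_weight K x)%:E =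
    (msol_moment K 1 p)%:E)%E.
Proof.
transitivity (\int[mu]_(x in I) \sum_(j < K) ((weight_coef R j)%:E * (p.[x] *
  chebV (1 + 2 * j) x)%:E))%E.
  apply: eq_integral => x _; rewrite /partial_weight mulr_sumr -sumEFin.
  by apply: eq_bigr => j _; rewrite -EFinM mulrCA.
have ii j := integrable_horner_chebV p (1 + 2 * j).
rewrite integral_sum //; last by move=> j; apply: integrableZl => //; exact: ii.
rewrite /msol_moment -sumEFin; apply: eq_bigr => j _.
rewrite integralZl //; last exact: ii.
rewrite EFinM /cheb_moment /Rintegral fineK //.
exact: integrable_fin_num (ii j).
Qed.

Lemma msol_moment_stable K p : (size p <= K)%N -> msol_moment K 1 p =
  msol_moment (size p) 1 p.
Proof.
move=> pK; rewrite -(subnKC pK); elim: (K - _)%N => [|k IH];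
  first by rewrite addn0.
rewrite addnS -{}IH /msol_moment big_ord_recr /= cheb_moment_small ?mulr0
  ?addr0 //.
by rewrite mulnDr mul2n -addnn -addnA leq_addr.
Qed.

Lemma continuous_partial_weight n : continuous (partial_weight n).
Proof.
apply: continuous_big => [x|j _ x]; first exact: add_continuous.
by apply: cvgM; [exact: cvg_cst|exact: continuous_chebV].
Qed.

(** The partial sums of the weight are bounded by 1/2, so |p| dominates. *)
Lemma weight_dominated p :
  mu.-integrable I (fun x => (p.[x] * weight x)%:E) /\
  (\int[mu]_(x in I) (p.[x] * partial_weight n x)%:E @[n --> \oo] -->
    \int[mu]_(x in I) (p.[x] * weight x)%:E)%E.
Proof.
have mp : measurable_fun I (horner p).
  by apply: measurable_funTS; apply: continuous_measurable_fun;
    exact: continuous_horner.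
have mw n : measurable_fun I (partial_weight n).
  apply: measurable_funTS; apply: continuous_measurable_fun.
  exact: continuous_partial_weight.
pose g (x : R) := (`|p.[x]|)%:E.
have ig : mu.-integrable I g.
  apply: continuous_compact_integrable; first exact: segment_compact.
  apply: continuous_subspaceT => x.
  by apply: cvg_norm; exact: continuous_horner.
have [//||||||H1 _ H2] := @dominated_convergence _ _ _ mu I _
  (fun n x => (p.[x] * partial_weight n x)%:E) (fun x =>
    (p.[x] * weight x)%:E) g.
- by move=> n; apply/measurable_EFinP; apply: measurable_funM;
  [exact: mp|exact: mw].
- apply/measurable_EFinP; apply: measurable_funM => //.
  by apply: (measurable_fun_cvg mw) => x _; exact: cvg_partial_weight.
- apply: aeW => x _; apply: cvg_EFin; first by near=> n.
  by apply: cvgM; [exact: cvg_cst|exact: cvg_partial_weight].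
- exact: ig.
- apply: aeW => x n _; rewrite /g /= lee_fin normrM ler_piMr //.
  by rewrite (le_trans (partial_weight_le _ _)) //; lra.
by split.
Unshelve. all: by end_near.
Qed.

Lemma weight_restrict p :
  (fun x => (p.[x] * weight x)%:E) = (fun x => (p.[x] * weight x)%:E) \_ I.
Proof.
apply/funext => x; rewrite /patch; case: ifPn => // /negP xI.
by rewrite weight_out ?mulr0 // => Ix; apply: xI; rewrite inE.
Qed.

Lemma integrable_weight p :
  mu.-integrable setT (fun x => (p.[x] * weight x)%:E).
Proof.
rewrite weight_restrict; apply/(integrable_mkcond _ _).1 => //.
by case: (weight_dominated p).
Qed.

Lemma integral_weight p :
  (\int[mu]_x (p.[x] * weight x)%:E = (msol_moment (size p) 1 p)%:E)%E.
Proof.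
rewrite weight_restrict -integral_mkcond; have [_ H] := weight_dominated p.
apply/esym; rewrite -(cvg_lim _ H) //; apply/esym/cvg_lim => //.
apply: cvg_near_cst; exists (size p) => // n /= pn.
by rewrite int_partial_weight msol_moment_stable.
Qed.

Lemma size_lead_qbar n : (size (qbar R n) <= n.+1)%N /\ 0 < (qbar R n)`_n.
Proof.
suff: ((size (qbar R n) <= n.+1)%N /\ 0 < (qbar R n)`_n) /\
  ((size (qbar R n.+1) <= n.+2)%N /\ 0 < (qbar R n.+1)`_n.+1) by case.
have szX p k : (size p <= k)%N -> (size ('X * p)%R <= k.+1)%N.
  move=> pk; rewrite (leq_trans (size_polyMleq _ _)) // size_polyX //.
elim: n => [|n [[IH0 IHc0] [IH1 IHc1]]].
  rewrite qbar1 qbar0; split; split.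
  - by rewrite (leq_trans (size_scale_leq _ _)) // size_polyC oner_neq0.
  - by rewrite coefZ coefC /= mulr1.
  - rewrite (leq_trans (size_scale_leq _ _)) //; apply: szX.
    by rewrite (leq_trans (size_scale_leq _ _)) // size_polyC oner_neq0.
  - by rewrite coefZ coefXM coefZ coefC /=; lra.
split => //; rewrite qbar_rec; split.
  rewrite (leq_trans (size_polyD _ _)) // geq_max; apply/andP; split.
    by rewrite (leq_trans (size_scale_leq _ _)) // szX.
  by rewrite (leq_trans (size_scale_leq _ _)) // (leq_trans IH0) // leqW.
rewrite coefD !coefZ coefXM /= (nth_default _ (_ : size (qbar R n) <= _)%N).
  rewrite mulr0 addr0 mulr_gt0 // divr_gt0 //; have := ler0n R n; lra.
by rewrite (leq_trans IH0) // leqW.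
Qed.

Lemma size_qbar n : size (qbar R n) = n.+1.
Proof.
have [sz c0] := size_lead_qbar n; apply/eqP; rewrite eqn_leq sz ltnNge.
by apply: contraTN c0 => h; rewrite nth_default // ltxx.
Qed.

(** By [msol_moment_qbar], this is a moment of the series Phi_(n+1)/Phi_0, which
    starts at sin((n + 1) t); the degree of p lets only that first term
    contribute. *)
Lemma msol_moment_qbar_lead n p : (size p <= n.+1)%N ->
  msol_moment (size (qbar R n * p)) 1 (qbar R n * p) =
  5^-1 * msol_ratio R n.+1 0 * (p`_n / 2 ^+ n * \int[mu]_(x in I) chebV 1 x).
Proof.
move=> pn; set s := size _; pose K := (maxn s (size p + n)).+1.
rewrite -(@msol_moment_stable K); last by rewrite leqW // leq_maxl.
have := @msol_moment_qbar R n K p; rewrite ltnS leq_maxr => /(_ isT) => E.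
apply: (mulfI (_ : 5 != 0 :> R)) => //;
  rewrite -E /msol_moment /K big_ord_recl /=.
rewrite big1 => [|j _]; first by rewrite addr0 muln0 addn0 cheb_moment_lead //;
  field.
rewrite addSn cheb_moment_small ?mulr0 // (leq_trans pn) //.
by rewrite /bump /= mulnDr muln1 addnA addn2 !addSn ltnS leqW ?leq_addr.
Qed.

End Weight.

Theorem theorem5p0p5 (R : realType) :
  (forall n : nat, size (qbar R n) = n.+1) /\
  exists w : R -> R, is_weight w /\ orthogonal_wrt (qbar R) w.
Proof.
split; first exact: size_qbar.
exists (@weight R); split; split.
- exact: weight_ge0.
- move=> k; rewrite (_ : (fun _ => _) =
  fun c => (('X^k : {poly R}).[c] * weight c)%:E).
    exact: integrable_weight.
  by apply/funext => c; rewrite hornerXn.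
- suff lt n m : (m < n)%N ->
    (\int[@lebesgue_measure R]_c
      ((qbar R n).[c] * (qbar R m).[c] * weight c)%:E = 0)%E.
    move=> n m; have [nm _|mn _|//] := ltngtP n m; last exact: lt.
    by rewrite -(lt m n nm); apply: eq_integral => c _;
      rewrite (mulrC (qbar R n).[c]).
  move=> mn; under eq_integral do rewrite -hornerM.
  rewrite integral_weight msol_moment_qbar_lead ?size_qbar ?leqW //.
  by rewrite nth_default ?size_qbar // !mul0r mulr0.
- move=> n.
  under eq_integral do rewrite real_normK ?num_real // expr2 -hornerM.
  rewrite integral_weight msol_moment_qbar_lead ?size_qbar // lte_fin.
  have [_ c0] := size_lead_qbar R n.
  by rewrite !mulr_gt0 ?invr_gt0 ?exprn_gt0 ?msol_ratio0_gt0
    ?itv_int_chebV1_gt0.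
Qed.
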